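(* Let $n\ge 1$ and let $\boldsymbol U^{(n-1)}\in X_{\mathrm d}$ and $\boldsymbol U^{(n)}\in X_{\mathrm d}$ be given. Then, for any time step size $\Delta t>0$ and any space step size $\Delta x=L/N$ (without any restriction on these), there exists a unique $\boldsymbol U^{(n+1)}\in X_{\mathrm d}$ satisfying $$\frac{U_k^{(n+1)}-U_k^{(n-1)}}{2\Delta t} = -\mathrm{i}\left((-\triangle)_{\mathrm d}^{\frac{\alpha}{2}}\,\frac{\boldsymbol U^{(n+1)}+\boldsymbol U^{(n-1)}}{2}\right)_k + \mathrm{i}\,\bigl|U_k^{(n)}\bigr|^2\,\frac{U_k^{(n+1)}+U_k^{(n-1)}}{2},\qquad k=0,\dots,N-1.$$
   Context: Let $1<\alpha\le 2$, $L>0$, let $N\ge 1$ be an odd integer, $\mu=2\pi/L$, $\mathrm i=\sqrt{-1}$. $X_{\mathrm d}$ is the space of $N$-periodic complex sequences $\boldsymbol U=\{U_k\}_{k\in\mathbb Z}$, $U_k\in\mathbb C$, $U_k=U_{k \bmod N}$, identified with vectors $(U_0,\dots,U_{N-1})^\top\in\mathbb C^N$. The unitary discrete Fourier transform is $(\mathcal F_{\mathrm d}\boldsymbol U)_k=\frac1{\sqrt N}\sum_{j=0}^{N-1}U_j e^{-2\pi \mathrm i jk/N}$, with inverse $(\mathcal F_{\mathrm d}^{-1}\hat{\boldsymbol U})_j=\frac1{\sqrt N}\sum_{k=0}^{N-1}\hat U_k e^{2\pi \mathrm i jk/N}$. Let $D_\alpha=\mathrm{diag}(d_0,\dots,d_{N-1})$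 with $d_p=|\mu p|^\alpha$ for $0\le p\le \frac{N-1}{2}$ and $d_p=|\mu(p-N)|^\alpha$ for $\frac{N+1}{2}\le p\le N-1$. The discrete fractional Laplacian is $(-\triangle)_{\mathrm d}^{\frac{\alpha}{2}}=\mathcal F_{\mathrm d}^{-1}D_\alpha\mathcal F_{\mathrm d}$. *)

(* Defs.v *)
From HB Require Import structures.
From mathcomp Require Import all_boot all_order all_algebra.
From mathcomp Require Import all_classical all_reals all_analysis.
From mathcomp Require Import complex.

Set Implicit Arguments.
Unset Strict Implicit.
Unset Printing Implicit Defensive.

Import Order.TTheory GRing.Theory Num.Theory.

Local Open Scope classical_set_scope.
Local Open Scope ring_scope.
Local Open Scope complex_scope.

(* Two-sided sequences are functions on int. For 0 < N, (k %% N)%Z is the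
   remainder in {0, ..., N-1}, also when k is negative. *)
Definition Xd (R : realType) (N : nat) : set (int -> R[i]) :=
  [set U | forall k : int, U k = U (k %% N%:Z)%Z].

(* e^{i t} *)
Definition expi (R : realType) (t : R) : R[i] := cos t +i* sin t.

(* The transforms read only the entries 0, ..., N-1 of their argument, and
   their values are N-periodic in the output index. *)
Definition dft (R : realType) (N : nat) (U : int -> R[i]) : int -> R[i] :=
  fun k => ((Num.sqrt N%:R)^-1)%:C *
    \sum_(0 <= j < N) U j%:Z * expi (- (2 * pi * j%:R * k%:~R / N%:R)).

Definition idft (R : realType) (N : nat) (V : int -> R[i]) : int -> R[i] :=
  fun j => ((Num.sqrt N%:R)^-1)%:C *
    \sum_(0 <= k < N) V k%:Z * expi (2 * pi * j%:~R * k%:R / N%:R).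

(* The entry d_p, meant for 0 <= p < N with N odd, where mu = 2 pi / L;
   `^ is the real power, and N.-1./2 is (N-1)/2. *)
Definition symbol (R : realType) (alpha L : R) (N p : nat) : R :=
  let mu := 2 * pi / L in
  if (p <= N.-1./2)%N then `|mu * p%:R| `^ alpha
  else `|mu * (p%:R - N%:R)| `^ alpha.

(* diag(d_0, ..., d_{N-1}) acting on N-periodic sequences: the entry of index
   k is multiplied by d_{k mod N}; the absolute value only converts the
   nonnegative remainder to nat. *)
Definition Dmul (R : realType) (alpha L : R) (N : nat) (V : int -> R[i]) :
    int -> R[i] :=
  fun k => (symbol alpha L N `|(k %% N%:Z)%Z|%N)%:C * V k.

Definition fracLap (R : realType) (alpha L : R) (N : nat) :
    (int -> R[i]) -> (int -> R[i]) :=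
  fun U => idft N (Dmul alpha L N (dft N U)).

(* One step of the scheme, with Uprev, Ucur, Unext at the time levels
   n-1, n, n+1. The norm `|z| of z : R[i] is the modulus, seen in R[i]. *)
Definition scheme (R : realType) (alpha L : R) (N : nat) (dt : R)
    (Uprev Ucur Unext : int -> R[i]) : Prop :=
  forall k : nat, (k < N)%N ->
    (Unext k%:Z - Uprev k%:Z) / (2 * dt%:C) =
      - 'i%C * fracLap alpha L N (fun j => (Unext j + Uprev j) / 2) k%:Z
      + 'i%C * `|Ucur k%:Z| ^+ 2 * ((Unext k%:Z + Uprev k%:Z) / 2).

(* Main.v *)
(** Written for the midpoint [W = (Unext + Uprev) / 2], the scheme reads
    [W + i dt (A - q) W = Uprev] with [A] the discrete fractional Laplacian and
    [q = |Ucur|^2]. Since [idft] is the adjoint of [dft] and the symbol is real,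
    [A - q] has a real quadratic form; pairing the homogeneous equation with [W]
    therefore gives [|W|^2 = - i r] with [r] real, whence [W = 0]. The linear
    system is square, so it is uniquely solvable. *)

From HB Require Import structures.
Require Import Defs.
From mathcomp Require Import all_boot all_order all_algebra.
From mathcomp Require Import all_classical all_reals all_analysis.
From mathcomp Require Import complex.
From mathcomp Require Import ring.

Import Order.TTheory GRing.Theory Num.Theory.

Local Open Scope classical_set_scope.
Local Open Scope ring_scope.
Local Open Scope complex_scope.

Lemma conj_real_complex (R : realType) (x : R) : ((x%:C)^*)%R = x%:C.
Proof. exact: conjc_real. Qed.

Lemma real_complex_real (R : realType) (x : R) : x%:C \is Num.real.
Proof. by rewrite CrealE conj_real_complex. Qed.

Lemma conj_expi (R : realType) (t : R) : ((expi t)^*)%R = expi (- t).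
Proof. by rewrite /expi cosN sinN. Qed.

(** Conjugating the kernel of [dft] flips the sign of the exponent and yields the kernel of [idft];
    both carry the same real factor [c], so exchanging the two sums suffices. *)
Lemma idft_adjoint (R : realType) (N : nat) (U V : int -> R[i]) :
  \sum_(0 <= k < N) (U k%:Z)^*%R * idft N V k%:Z =
  \sum_(0 <= p < N) (dft N U p%:Z)^*%R * V p%:Z.
Proof.
rewrite /idft /dft; set c := _%:C.
under eq_bigr do rewrite mulrCA big_distrr /= big_distrr /=.
rewrite exchange_big /=; apply: eq_bigr => p _.
rewrite rmorphM rmorph_sum /= conj_real_complex big_distrr /= big_distrl /=.
apply: eq_bigr => k _.
by rewrite rmorphM /= conj_expi opprK -[k%:~R]/(k%:R) -[p%:~R]/(p%:R); ring.
Qed.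

(** Moving [idft] across the pairing turns each term into a real symbol value times the squared
    modulus of a Fourier coefficient. *)
Lemma fracLap_form_real (R : realType) (alpha L : R) (N : nat)
    (U : int -> R[i]) :
  \sum_(0 <= k < N) (U k%:Z)^*%R * fracLap alpha L N U k%:Z \is Num.real.
Proof.
rewrite idft_adjoint; apply: sum_real => p _.
by rewrite /Dmul mulrCA realM ?real_complex_real// mulrC -normCK realX.
Qed.

Lemma dft_linear (R : realType) (N : nat) (a : R[i]) (U V : int -> R[i]) k :
  dft N (fun j => a * U j + V j) k = a * dft N U k + dft N V k.
Proof.
rewrite /dft mulrCA -mulrDr; congr (_ * _).
by rewrite big_distrr -big_split; apply: eq_bigr => j _ /=; ring.
Qed.

Lemma idft_linear (R : realType) (N : nat) (a : R[i]) (U V : int -> R[i]) k :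
  idft N (fun j => a * U j + V j) k = a * idft N U k + idft N V k.
Proof.
rewrite /idft mulrCA -mulrDr; congr (_ * _).
by rewrite big_distrr -big_split; apply: eq_bigr => j _ /=; ring.
Qed.

Lemma fracLap_linear (R : realType) (alpha L : R) (N : nat) (a : R[i])
    (U V : int -> R[i]) k :
  fracLap alpha L N (fun j => a * U j + V j) k =
  a * fracLap alpha L N U k + fracLap alpha L N V k.
Proof.
rewrite /fracLap -idft_linear; congr (idft _ _ _); apply: funext => p.
by rewrite /Dmul dft_linear; ring.
Qed.

Lemma Xd_ext (R : realType) (N : nat) (U V : int -> R[i]) : (0 < N)%N ->
  Xd N U -> Xd N V -> (forall k : nat, (k < N)%N -> U k%:Z = V k%:Z) -> U = V.
Proof.
move=> N0 UN VN UV; apply: funext => k; rewrite UN VN.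
have := modz_ge0 k (d := N%:Z); have := ltz_pmod k (d := N%:Z).
case: (k %% N%:Z)%Z => m; last first.
  by move=> _; case: N {UN VN UV} N0 => // N _ /(_ isT).
by move=> /(_ N0) mN _; apply: UV.
Qed.

(** Restricted to periodic extensions of row vectors and read at the indices below [N], [T] is a
    linear endomorphism of a space of dimension [N]; trivial kernel makes it invertible, hence
    onto. *)
Lemma periodic_system_solvable (R : realType) (N : nat)
    (T : (int -> R[i]) -> int -> R[i]) : (0 < N)%N ->
  (forall a U V k, T (fun j => a * U j + V j) k = a * T U k + T V k) ->
  (forall U, (forall k : nat, (k < N)%N -> T U k%:Z = 0) ->
     forall k : nat, (k < N)%N -> U k%:Z = 0) ->
  forall P : int -> R[i],
  exists2 U, Xd N U & forall k : nat, (k < N)%N -> T U k%:Z = P k%:Z.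
Proof.
case: N => // n _ Tlin Tinj P.
(* The periodic extension of a row vector; [inord] never takes its default value, the remainder
   being below [n.+1]. *)
pose ext (w : 'rV[R[i]]_n.+1) (k : int) := w 0 (inord `|(k %% n.+1%:Z)%Z|).
have extE w (k : 'I_n.+1) : ext w k = w 0 k.
  by rewrite /ext modz_nat modn_small // inord_val.
pose f w : 'rV[R[i]]_n.+1 := \row_k T (ext w) k%:Z.
have flin : linear f.
  move=> a u v; apply/rowP => k; rewrite !mxE -Tlin; congr (T _ _).
  by apply: funext => j; rewrite /ext !mxE.
pose fL : {linear 'rV[R[i]]_n.+1 -> 'rV[R[i]]_n.+1} :=
  HB.pack f (GRing.isLinear.Build _ _ _ _ f flin).
have fu : lin1_mx fL \in unitmx.
  rewrite -row_free_unit; apply: inj_row_free => v; rewrite mul_rV_lin1 => fv0.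
  apply/rowP => k; rewrite mxE -extE; apply: Tinj (ltn_ord k) => j jn.
  by have /rowP/(_ (Ordinal jn)) := fv0; rewrite !mxE.
exists (ext ((\row_k P k%:Z) *m invmx (lin1_mx fL))).
  by move=> k; rewrite /ext modz_mod.
move=> k kn; have : fL ((\row_k P k%:Z) *m invmx (lin1_mx fL)) = \row_k P k%:Z.
  by rewrite -mul_rV_lin1 mulmxKV.
by move/rowP/(_ (Ordinal kn)); rewrite !mxE.
Qed.

Definition midpoint_op {R : realType} (alpha L : R) (N : nat) (dt : R)
    (Ucur W : int -> R[i]) (k : int) : R[i] :=
  W k + 'i%C * dt%:C * (fracLap alpha L N W k - `|Ucur k| ^+ 2 * W k).

Lemma midpoint_op_linear (R : realType) (alpha L : R) (N : nat) (dt : R)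
    (Ucur : int -> R[i]) (a : R[i]) (U V : int -> R[i]) k :
  midpoint_op alpha L N dt Ucur (fun j => a * U j + V j) k =
  a * midpoint_op alpha L N dt Ucur U k + midpoint_op alpha L N dt Ucur V k.
Proof. by rewrite /midpoint_op fracLap_linear; ring. Qed.

Lemma midpoint_op_inj (R : realType) (alpha L : R) (N : nat) (dt : R)
    (Ucur W : int -> R[i]) :
  (forall k : nat, (k < N)%N -> midpoint_op alpha L N dt Ucur W k%:Z = 0) ->
  forall k : nat, (k < N)%N -> W k%:Z = 0.
Proof.
move=> W0.
pose s : R[i] := \sum_(0 <= k < N) `|W k%:Z| ^+ 2.
pose r := dt%:C * (\sum_(0 <= k < N) (W k%:Z)^*%R * fracLap alpha L N W k%:Z
   - \sum_(0 <= k < N) `|Ucur k%:Z| ^+ 2 * `|W k%:Z| ^+ 2).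
(* Multiply the equation of index [k] by the conjugate of [W k] and sum over [k]. *)
have sr : s = - ('i * r)%R.
  apply/eqP; rewrite -addr_eq0 /r /s -sumrB !big_distrr -big_split /=.
  rewrite big_nat_cond big1 // => k; rewrite andbT => /andP[_ kN].
  have := congr1 (fun x => (W k%:Z)^*%R * x) (W0 k kN).
  rewrite /midpoint_op mulr0 -complexiE => <-.
  by rewrite ![`|W _| ^+ 2]normCK; ring.
have s_real : s^*%R = s.
  by apply: conj_Creal; apply: sum_real => k _; rewrite realX.
have r_real : r^*%R = r.
  apply: conj_Creal; rewrite realM ?real_complex_real//.
  rewrite realB ?fracLap_form_real//.
  by apply: sum_real => k _; rewrite realM ?realX.
(* As [s] and [r] are real, conjugating [s = - 'i * r] gives [s = 'i * r = - s]. *)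
have s0 : s = 0.
  have : s = - s.
    by rewrite -[LHS]s_real {1}sr rmorphN rmorphM /= conjCi r_real mulNr -sr.
  by move/eqP; rewrite -addr_eq0 -mulr2n mulrn_eq0 /= => /eqP.
move=> k kN; move/eqP: s0; rewrite /s big_mkord psumr_eq0; last first.
  by move=> i _; rewrite exprn_ge0.
move=> /allP/(_ (Ordinal kN)); rewrite mem_index_enum => /(_ isT) /=.
by rewrite expf_eq0 normr_eq0 => /eqP.
Qed.

(** With [W] the midpoint, [Unext - Uprev = 2 (W - Uprev)], so the difference quotient is
    [(W - Uprev) / dt]; multiplying by the nonzero [dt] is reversible. *)
Lemma schemeE (R : realType) (alpha L : R) (N : nat) (dt : R)
    (Uprev Ucur Unext : int -> R[i]) : 0 < dt ->
  scheme alpha L N dt Uprev Ucur Unext <->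
  forall k : nat, (k < N)%N ->
    midpoint_op alpha L N dt Ucur (fun j => (Unext j + Uprev j) / 2) k%:Z =
    Uprev k%:Z.
Proof.
move=> dt0; have d0 : dt%:C != 0 :> R[i] by rewrite fmorph_eq0 gt_eqF.
rewrite /scheme /midpoint_op; split=> H k kN; have := H k kN;
  set A := fracLap _ _ _ _ _; set q := _ ^+ 2;
  set u := Unext _; set v := Uprev _.
- move=> E.
  (* Only the free-standing midpoint is expanded this way, to expose the quotient that the scheme
     prescribes; the one multiplied by [q] stays. *)
  have mid : (u + v) / 2 = v + dt%:C * ((u - v) / (2 * dt%:C)) by field.
  by rewrite {1}mid E; ring.
- move=> E.
  have -> : u - v = 2 * ((u + v) / 2 - v) by field.
  by rewrite -{2}E; field.
Qed.

Theorem theorem3 (R : realType) (alpha L : R) (N : nat)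
    (halpha : 1 < alpha <= 2) (hL : 0 < L) (hN : (1 <= N)%N) (hNodd : odd N)
    (Uprev Ucur : int -> R[i]) (hprev : Xd N Uprev) (hcur : Xd N Ucur)
    (dt : R) (hdt : 0 < dt) :
  exists! Unext : int -> R[i],
    Xd N Unext /\ scheme alpha L N dt Uprev Ucur Unext.
Proof.
have [W WN WP] := periodic_system_solvable R N
  (midpoint_op alpha L N dt Ucur) hN (midpoint_op_linear R alpha L N dt Ucur)
  (midpoint_op_inj R alpha L N dt Ucur) Uprev.
(* The witness solves [W = (Unext + Uprev) / 2] for [Unext]. *)
exists (fun j => 2 * W j - Uprev j); split.
  split; first by move=> k; rewrite WN hprev.
  apply/schemeE => // k kN; rewrite -WP //; congr (midpoint_op _ _ _ _ _ _ _).
  by apply: funext => j; field.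
move=> V [VN /schemeE-/(_ hdt) VP].
apply: (Xd_ext _ _ _ _ hN _ VN) => [k|k kN]; first by rewrite WN hprev.
(* The midpoints of the two solutions have the same image [Uprev] below [N], so injectivity applies
   to their difference, written as [a * U + V] with [a = -1] to fit the linearity lemma. *)
have : -1 * W k%:Z + (V k%:Z + Uprev k%:Z) / 2 = 0.
  apply: (midpoint_op_inj R alpha L N dt Ucur
    (fun j => -1 * W j + (V j + Uprev j) / 2)) kN => j jN.
  by rewrite midpoint_op_linear WP // VP // mulN1r addNr.
rewrite mulN1r addrC => /eqP; rewrite subr_eq0 => /eqP <-.
by field.
Qed.
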